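(* Let $X$ be a complex vector space and let $\mathfrak{t},\mathfrak{w}\in\mathcal{F}^+(X)$ be nonnegative sesquilinear forms on $X$. Let $\mathfrak{t}_s$ be the form given by $\mathfrak{t}_s(x,y)=\lim_{n\to\infty}\mu_{\mathfrak{w}}^{[n]}(\mathfrak{t})(x,y)$, $x,y\in X$, where $\mu_{\mathfrak{w}}^{[0]}(\mathfrak{t}):=\mathfrak{t}$, $\mu_{\mathfrak{w}}^{[n]}(\mathfrak{t}):=\mu_{\mathfrak{w}}(\mu_{\mathfrak{w}}^{[n-1]}(\mathfrak{t}))$ and $\mu_{\mathfrak{w}}(\mathfrak{s}):=\mathfrak{s}-\mathfrak{s}:\mathfrak{w}$, with $:$ denoting the parallel sum of forms. Then $\mathfrak{t}=(\mathfrak{t}-\mathfrak{t}_s)+\mathfrak{t}_s$ is a Lebesgue-type decomposition of $\mathfrak{t}$ with respect to $\mathfrak{w}$ (that is, $\mathfrak{t}-\mathfrak{t}_s\ll\mathfrak{w}$, and $\mathfrak{t}_s$ and $\mathfrak{w}$ are mutually singular), where $$\mathfrak{t}-\mathfrak{t}_s=\max\{\mathfrak{s}\in\mathcal{F}^+(X)\,:\,\mathfrak{s}\le\mathfrak{t},\ \mathfrak{s}\ll\mathfrak{w}\},$$ the maximum (largest element) being taken with respect to $\le$.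
   Context: $\mathcal{F}^+(X)$ is the set of nonnegative sesquilinear forms on $X$ (linear in the first, conjugate-linear in the second variable), and $\mathfrak{t}[x]:=\mathfrak{t}(x,x)$. $\mathfrak{t}\le\mathfrak{w}$ means $\mathfrak{t}[x]\le\mathfrak{w}[x]$ for all $x\in X$. $\mathfrak{t}\ll\mathfrak{w}$ ($\mathfrak{t}$ is $\mathfrak{w}$-closable) means: for every sequence $(x_n)$ in $X$, $\mathfrak{t}[x_n-x_m]\to0$ (as $n,m\to\infty$) and $\mathfrak{w}[x_n]\to0$ imply $\mathfrak{t}[x_n]\to0$. $\mathfrak{t}$ and $\mathfrak{w}$ are mutually singular if $\mathfrak{s}\in\mathcal{F}^+(X)$, $\mathfrak{s}\le\mathfrak{t}$, $\mathfrak{s}\le\mathfrak{w}$ imply $\mathfrak{s}=0$. The parallel sum $\mathfrak{t}:\mathfrak{w}$ is the unique nonnegative form with $(\mathfrak{t}:\mathfrak{w})[x]=\inf\{\mathfrak{w}[x-y]+\mathfrak{t}[y]:y\in X\}$ for all $x\in X$; it exists, and $\mathfrak{t}:\mathfrak{w}\le\mathfrak{t}$, so $\mu_{\mathfrak{w}}$ maps $\mathcal{F}^+(X)$ into itself. The limit defining $\mathfrak{t}_s$ exists and $\mathfrak{t}_s\in\mathcal{F}^+(X)$. *)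

(* Defs.v *)
From HB Require Import structures.
From mathcomp Require Import all_boot all_order all_algebra.
From mathcomp Require Import all_classical all_reals all_analysis.
From mathcomp Require Import complex.

Set Implicit Arguments.
Unset Strict Implicit.
Unset Printing Implicit Defensive.

Import Order.TTheory GRing.Theory Num.Theory numFieldNormedType.Exports.

Local Open Scope classical_set_scope.
Local Open Scope ring_scope.

Section Forms.
Variables (R : realType) (X : lmodType R[i]).
Implicit Types (t w s p : X -> X -> R[i]).

(* In the partial order of R[i], 0 <= z means that z is real and nonnegative. *)
Definition nnform t : Prop :=
  [/\ forall y, GRing.linear_for *%R (t ^~ y),
      forall x, GRing.linear_for (Num.conj \; *%R) (t x)
    & forall x, 0 <= t x x].

(* t[x]; taking the real part loses nothing, since t x x is real when t is a
   nonnegative form. *)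
Definition quad t (x : X) : R := complex.Re (t x x).

Definition form_le t w : Prop := forall x, quad t x <= quad w x.

Definition closable t w : Prop :=
  forall u : nat -> X,
    quad t (u nm.1 - u nm.2) @[nm --> (\oo, \oo)] --> (0 : R) ->
    quad w (u n) @[n --> \oo] --> (0 : R) ->
    quad t (u n) @[n --> \oo] --> (0 : R).

Definition mutually_singular t w : Prop :=
  forall s, nnform s -> form_le s t -> form_le s w -> s = 0.

Definition is_parallel_sum t w p : Prop :=
  nnform p /\
  forall x, quad p x = inf [set quad w (x - y) + quad t y | y in [set: X]].

(* For nonnegative t and w exactly one p satisfies is_parallel_sum t w p, so
   the default value 0 of xget is irrelevant. *)
Definition parallel_sum t w : X -> X -> R[i] :=
  xget (0 : X -> X -> R[i]) [set p | is_parallel_sum t w p].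

Definition mu w s : X -> X -> R[i] := s - parallel_sum s w.

(* The limit is taken in R[i] with the topology of its modulus, carried by the
   alias R[i]^o. *)
Definition singular_part t w : X -> X -> R[i] :=
  fun x y => limn (fun n => iter n (mu w) t x y : R[i]^o).

Definition lebesgue_type_decomposition t w r s : Prop :=
  [/\ nnform r, nnform s, t = r + s, closable r w & mutually_singular s w].

Definition is_largest (F : set (X -> X -> R[i])) t : Prop :=
  F t /\ forall s, F s -> form_le s t.

End Forms.

(* Main.v *)
Require Import Defs.
From HB Require Import structures.
From mathcomp Require Import all_boot all_order all_algebra.
From mathcomp Require Import all_classical all_reals all_analysis.
From mathcomp Require Import complex ring lra.

Import Order.TTheory GRing.Theory Num.Theory numFieldNormedType.Exports.

Local Open Scope classical_set_scope.
Local Open Scope ring_scope.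

(** Write [T n] for the iterates of [t], so that [T n - T n.+1 = T n : w] is a
nonnegative form below both [T n] and [w]. The iterates decrease to a form [u],
which is the singular part; three facts give the theorem.

- [t - u] is the supremum of the forms [t - T n], a sum of [n] forms below [w],
  hence below [n w]. An increasing limit of forms dominated by multiples of [w]
  is [w]-closable: if [z] is Cauchy for [t - u] and [w[z n]] tends to [0], the
  bound for [(t - T N)[z n - z m]] passes to the limit in [m], then in [N]
  ([closable_of_dominated]).

- If [s <= u] and [s <= w], then [s / 2 = s : s <= T n : w], and the right-hand
  side is a difference of consecutive terms of a convergent sequence, so [s = 0]
  ([mutually_singular_limit]).

- Maximality. In the completion for [t + w] all the iterates are functions of
  one operator, and [u] is the form of the projection [P] onto the kernel of
  [w]. The completion is avoided by approximating [P x] inside [X]. The numbers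
  [(T j : w)[x]] decrease and have a convergent sum, so
  [(2 k + 1) (T (2 k) : w)[x]] tends to [0]. A vector [z k] that almost attains
  the infimum defining [(T (2 k) : w)[x]] therefore makes [(2 k + 1) w[z k]] and
  [T (2 k)[x - z k]] small, and then also [(t - T (2 k))[z k]], which is at most
  [2 k w[z k]] ([approx_singular_component]). These three bounds make [z]
  Cauchy for [t]. If [s <= t] is [w]-closable, then [s[z k]] tends to [0], and
  [s[x]] is the limit of [s[x - z k] <= t[x - z k]], whose limit is at most
  [(t - u)[x]] ([closable_le_at]).

The parallel sum and the limit [u] are first given by their quadratic
functionals; the forms come from the Jordan-von Neumann theorem
([nnform_polar]), which over the complex numbers is purely algebraic. *)

(** * Nonnegative forms and their quadratic functionals *)

Section FormAlgebra.
Set Implicit Arguments.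
Unset Strict Implicit.
Context {R : realType} {X : lmodType R[i]}.
Implicit Types (t s : X -> X -> R[i]) (x y : X) (a b : R[i]).

Local Notation Re := complex.Re.
Local Notation Im := complex.Im.

Lemma complex_ext a b : Re a = Re b -> Im a = Im b -> a = b.
Proof. by case: a => p q; case: b => r u /= -> ->. Qed.

Lemma ReD a b : Re (a + b) = Re a + Re b. Proof. by case: a; case: b. Qed.
Lemma ImD a b : Im (a + b) = Im a + Im b. Proof. by case: a; case: b. Qed.
Lemma ReN a : Re (- a) = - Re a. Proof. by case: a. Qed.
Lemma ImN a : Im (- a) = - Im a. Proof. by case: a. Qed.
Lemma ReM a b : Re (a * b) = Re a * Re b - Im a * Im b.
Proof. by case: a; case: b. Qed.
Lemma ImM a b : Im (a * b) = Re a * Im b + Im a * Re b.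
Proof. by case: a => p q; case: b => r u. Qed.
Lemma Re_conj a : Re (Num.conj a) = Re a. Proof. by case: a. Qed.
Lemma Im_conj a : Im (Num.conj a) = - Im a. Proof. by case: a. Qed.

Definition ReImE := (ReD, ImD, ReN, ImN, ReM, ImM, Re_conj, Im_conj).

Section OneForm.
Context {t : X -> X -> R[i]} (ht : nnform t).

Lemma formDl x x' y : t (x + x') y = t x y + t x' y.
Proof. by case: ht => h _ _; rewrite -[x in LHS]scale1r h mul1r. Qed.

Lemma form0l y : t 0 y = 0.
Proof. by apply: (addrI (t 0 y)); rewrite -formDl !addr0. Qed.

Lemma formZl a x y : t (a *: x) y = a * t x y.
Proof. by case: ht => h _ _; rewrite -[_ *: _]addr0 h form0l addr0. Qed.

Lemma formNl x y : t (- x) y = - t x y.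
Proof. by rewrite -scaleN1r formZl mulN1r. Qed.

Lemma formDr x y y' : t x (y + y') = t x y + t x y'.
Proof.
by case: ht => _ h _; rewrite -[y in LHS]scale1r h /= rmorph1 mul1r.
Qed.

Lemma form0r x : t x 0 = 0.
Proof. by apply: (addrI (t x 0)); rewrite -formDr !addr0. Qed.

Lemma formZr a x y : t x (a *: y) = Num.conj a * t x y.
Proof. by case: ht => _ h _; rewrite -[_ *: _]addr0 h form0r addr0. Qed.

Lemma formNr x y : t x (- y) = - t x y.
Proof. by rewrite -scaleN1r formZr rmorphN1 mulN1r. Qed.

Definition formE := (formDl, formDr, formZl, formZr, formNl, formNr).

Lemma quad_ge0 x : 0 <= quad t x.
Proof. by case: ht => _ _ /(_ x); rewrite lecE => /andP[]. Qed.

Lemma Im_form_diag x : Im (t x x) = 0.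
Proof. by case: ht => _ _ /(_ x); rewrite lecE => /andP[/eqP]. Qed.

(** Realness of the diagonal forces hermitian symmetry: compare the imaginary
parts at [x + y] and at [x + i y]. *)
Lemma form_herm x y : t y x = Num.conj (t x y).
Proof.
have h1 := Im_form_diag (x + y).
have h2 := Im_form_diag (x + 'i%C *: y).
move: h1 h2; rewrite !formE !ReImE !Im_form_diag /= => h1 h2.
apply: complex_ext; rewrite !ReImE; lra.
Qed.

Lemma quadD x y : quad t (x + y) = quad t x + quad t y + 2 * Re (t x y).
Proof. by rewrite /quad !formE (form_herm x y) !ReImE; ring. Qed.

Lemma quadZ a x : quad t (a *: x) = (Re a ^+ 2 + Im a ^+ 2) * quad t x.
Proof.
by rewrite /quad !formE !ReImE Im_form_diag; ring.
Qed.

Lemma quadN x : quad t (- x) = quad t x.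
Proof. by rewrite /quad !formE opprK. Qed.

Lemma quad0 : quad t 0 = 0.
Proof. by rewrite /quad form0l. Qed.

Lemma quad_subC x y : quad t (x - y) = quad t (y - x).
Proof. by rewrite -quadN opprB. Qed.

Lemma quad_parallelogram x y :
  quad t (x + y) + quad t (x - y) = 2 * quad t x + 2 * quad t y.
Proof. by rewrite !quadD quadN formNr ReN; ring. Qed.

Lemma quadD_le x y : quad t (x + y) <= 2 * quad t x + 2 * quad t y.
Proof. by rewrite -quad_parallelogram lerDl quad_ge0. Qed.

Lemma quadB_le x y : quad t (x - y) <= 2 * quad t x + 2 * quad t y.
Proof. by rewrite -quad_parallelogram lerDr quad_ge0. Qed.

(** The quadratic substitute for the triangle inequality of the seminorm
[sqrt t[x]]; as [d] tends to [0] the coefficient of [t[x]] tends to [1]. *)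
Lemma quadD_le_weighted (d : R) x y : 0 < d ->
  quad t (x + y) <= (1 + d) * quad t x + (1 + d^-1) * quad t y.
Proof.
move=> d0; have := quad_ge0 (d%:C%C *: x - y).
rewrite !quadD quadN quadZ !formE !ReImE /= => h.
have e : 2 * Re (t x y) <= d * quad t x + d^-1 * quad t y.
  rewrite -(ler_pM2l d0) mulrDr [d * (d^-1 * _)]mulrA mulfV ?gt_eqF // mul1r.
  by move: h; rewrite !(mul0r, oppr0, addr0, subr0, expr0n) /= => h; lra.
lra.
Qed.

End OneForm.

(** The polarization formula for forms linear in the first variable; the second
component is the real part of the formula at [(x, 'i y)]. *)
Definition polar (Q : X -> R) x y : R[i] :=
  Complex ((Q (x + y) - Q (x - y)) / 4)
          ((Q (x + 'i%C *: y) - Q (x - 'i%C *: y)) / 4).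

Lemma polar_quad t : nnform t -> t = polar (quad t).
Proof.
move=> ht; apply/funext => x; apply/funext => y; rewrite /polar.
rewrite !(quadD ht) !(quadN ht) !(formE ht).
apply: complex_ext; rewrite /= !ReImE /=. all: by field.
Qed.

Lemma quad_inj t s : nnform t -> nnform s -> quad t =1 quad s -> t = s.
Proof.
by move=> ht hs /funext e; rewrite (polar_quad ht) (polar_quad hs) e.
Qed.

Lemma quad_sub t s x : quad (t - s) x = quad t x - quad s x.
Proof. by rewrite /quad !fctE ReD ReN. Qed.

Lemma nnform_sub t s : nnform t -> nnform s -> form_le s t -> nnform (t - s).
Proof.
move=> ht hs st; split=> [y a u v|x a u v|x]; rewrite /= ?fctE.
- by rewrite !(formE ht) !(formE hs); ring.
- by rewrite !(formE ht) !(formE hs); ring.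
rewrite lecE !ReImE (Im_form_diag ht) (Im_form_diag hs) subr0 eqxx /=.
by rewrite subr_ge0; exact: st.
Qed.

Lemma nnform0 : nnform (0 : X -> X -> R[i]).
Proof. by split=> [y a u v|x a u v|x] /=; rewrite ?mulr0 ?addr0. Qed.

End FormAlgebra.

(** * The Jordan-von Neumann theorem *)

Section JordanVonNeumann.
Set Implicit Arguments.
Unset Strict Implicit.
Context {R : realType} {X : lmodType R[i]}.
Implicit Types (x y : X) (a b : R[i]).

Local Notation Re := complex.Re.
Local Notation Im := complex.Im.

Variable Q : X -> R.
Hypothesis Q_ge0 : forall x, 0 <= Q x.
Hypothesis Q_scale_le : forall a x, Q (a *: x) <= (Re a ^+ 2 + Im a ^+ 2) * Q x.
Hypothesis Q_par_le : forall x y, Q (x + y) + Q (x - y) <= 2 * Q x + 2 * Q y.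

Let QZ a x : Q (a *: x) = (Re a ^+ 2 + Im a ^+ 2) * Q x.
Proof.
apply/eqP; rewrite eq_le Q_scale_le /=.
have [->|a0] := eqVneq a 0.
  by rewrite /= !expr0n /= addr0 mul0r Q_ge0.
have m0 : 0 < Re a ^+ 2 + Im a ^+ 2.
  rewrite lt_neqAle addr_ge0 ?sqr_ge0 // andbT eq_sym paddr_eq0 ?sqr_ge0 //.
  rewrite !sqrf_eq0; apply: contra a0 => /andP[/eqP r /eqP i].
  by apply/eqP/complex_ext; rewrite ?r ?i.
rewrite -ler_pdivlMl //.
have := Q_scale_le a^-1 (a *: x); rewrite scalerA mulVf // scale1r.
suff -> : Re a^-1 ^+ 2 + Im a^-1 ^+ 2 = (Re a ^+ 2 + Im a ^+ 2)^-1 by [].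
case: {x} a a0 m0 => p q /= _ m0; field; exact: lt0r_neq0.
Qed.

Let QZr (r : R) x : Q (r%:C%C *: x) = r ^+ 2 * Q x.
Proof. by rewrite QZ /= expr0n addr0. Qed.

Let Q0 : Q 0 = 0.
Proof. by rewrite -(scale0r 0) QZ /= expr0n addr0 mul0r. Qed.

Let QN x : Q (- x) = Q x.
Proof. by rewrite -scaleN1r QZ /= oppr0 expr0n sqrrN expr1n addr0 mul1r. Qed.

(* The reverse inequality is the given one at [x + y] and [x - y]. *)
Let Q_par x y : Q (x + y) + Q (x - y) = 2 * Q x + 2 * Q y.
Proof.
apply/eqP; rewrite eq_le Q_par_le /=.
have := Q_par_le (x + y) (x - y).
have -> : x + y + (x - y) = (2 : R)%:C%C *: x.
  by rewrite rmorphMn /= rmorph1 scaler_nat addrACA subrr addr0 mulr2n.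
have -> : x + y - (x - y) = (2 : R)%:C%C *: y.
  rewrite rmorphMn /= rmorph1 scaler_nat opprB addrC addrA subrK.
  by rewrite mulr2n.
by rewrite !QZr; lra.
Qed.

Let B x y := (Q (x + y) - Q (x - y)) / 4.

Let B0 y : B 0 y = 0.
Proof. by rewrite /B add0r sub0r QN subrr mul0r. Qed.

Let BC x y : B x y = B y x.
Proof. by rewrite /B (addrC x) -(QN (x - y)) opprB. Qed.

(* The parallelogram law at [x + y, x'] minus the law at [x - y, x']. *)
Let B_pair x x' y : B (x + x') y + B (x - x') y = 2 * B x y.
Proof.
have h1 := Q_par (x + y) x'; have h2 := Q_par (x - y) x'.
rewrite /B (addrAC x x' y) (addrAC x (- x') y) (addrAC x x' (- y)).
by rewrite (addrAC x (- x') (- y)); lra.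
Qed.

Let BD x x' y : B (x + x') y = B x y + B x' y.
Proof.
pose h : R := 1 / 2.
have dbl z : B (z + z) y = 2 * B z y by rewrite -(B_pair z z) subrr B0 addr0.
have hh z : h%:C%C *: z + h%:C%C *: z = z.
  by rewrite -scalerDl -rmorphD /h /= -splitr scale1r.
have := B_pair (h%:C%C *: (x + x')) (h%:C%C *: (x - x')) y.
rewrite -dbl hh -scalerDr -scalerBr => <-; congr (B _ y + B _ y).
  by rewrite addrACA subrr addr0 scalerDr hh.
by rewrite opprB [x + x']addrC -addrA [x + _]addrCA subrr addr0 scalerDr hh.
Qed.

Let BNl x y : B (- x) y = - B x y.
Proof. by apply/eqP; rewrite -addr_eq0 -BD addNr B0. Qed.

Let BNr x y : B x (- y) = - B x y.
Proof. by rewrite BC BNl BC. Qed.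

Let BDr x y y' : B x (y + y') = B x y + B x y'.
Proof. by rewrite BC BD !(BC _ x). Qed.

Let BZZ a x y : B (a *: x) (a *: y) = (Re a ^+ 2 + Im a ^+ 2) * B x y.
Proof. by rewrite /B -scalerDr -scalerBr !QZ; field. Qed.

Let Bi x y : B ('i%C *: x) y = - B x ('i%C *: y).
Proof.
have := BZZ 'i%C x ('i%C *: y).
rewrite scalerA -expr2 sqr_i scaleN1r BNr /= expr0n expr1n add0r mul1r.
by move=> <-; rewrite opprK.
Qed.

(* Multiplying both arguments by [1 + 'i r] multiplies [B] by [1 + r ^+ 2]; the
   cross terms must cancel, so multiplication by ['i r] is antisymmetric for
   [B], like multiplication by ['i]. *)
Let B_real_sym (r : R) x y : B (r%:C%C *: x) y = B x (r%:C%C *: y).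
Proof.
pose c : R[i] := Complex 1 r.
have cE z : c *: z = z + 'i%C *: (r%:C%C *: z).
  rewrite scalerA -[z in z + _]scale1r -scalerDl; congr (_ *: _).
  by apply: complex_ext; rewrite !ReImE /=; ring.
have iE z : 'i%C *: (r%:C%C *: z) = r%:C%C *: ('i%C *: z).
  by rewrite !scalerA mulrC.
pose v := - ('i%C *: y).
have iv : 'i%C *: v = y by rewrite scalerN scalerA -expr2 sqr_i scaleN1r opprK.
have h1 := BZZ ('i%C * r%:C%C) x v; have h2 := BZZ c x v.
move: h1 h2; rewrite -!scalerA !cE BD !BDr => ->.
rewrite [B (_ *: _) v]Bi iv [in B x (_ *: _)]iE iv !ReImE /=; lra.
Qed.

(* Nonnegative reals are squares, so no continuity in [r] is involved. *)
Let BZ (r : R) x y : B (r%:C%C *: x) y = r * B x y.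
Proof.
wlog r0 : r / 0 <= r => [hw|].
  have [/hw//|/ltW r0] := leP 0 r.
  have := hw (- r); rewrite oppr_ge0 rmorphN scaleNr BNl => /(_ r0); lra.
rewrite -[r]sqr_sqrtr // expr2 rmorphM -scalerA B_real_sym BZZ /=.
by rewrite expr0n addr0 -expr2.
Qed.

Let scale_split a x : a *: x = (Re a)%:C%C *: x + (Im a)%:C%C *: ('i%C *: x).
Proof. by rewrite scalerA -scalerDl [in LHS](complexE a) [in LHS]mulrC. Qed.

Let BZl a x y : B (a *: x) y = Re a * B x y - Im a * B x ('i%C *: y).
Proof. by rewrite (scale_split a) BD !BZ Bi mulrN. Qed.

Let BZr a x y : B x (a *: y) = Re a * B x y + Im a * B x ('i%C *: y).
Proof. by rewrite (scale_split a) BDr ![B x (_%:C%C *: _)]BC !BZ ![B _ x]BC. Qed.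

Let polarE x y : polar Q x y = Complex (B x y) (B x ('i%C *: y)).
Proof. by []. Qed.

Let B_diag x : B x x = Q x.
Proof.
have := Q_par x x; rewrite /B subrr Q0; lra.
Qed.

Let B_diag_i x : B x ('i%C *: x) = 0.
Proof. have := Bi x x; rewrite BC; lra. Qed.

(** Only two inequalities are assumed, which is what infima of forms provide;
each implies its own converse by substitution. Real homogeneity of the polar
form usually needs continuity, but homogeneity of [Q] under complex scalars
gives [B (r x) y = B x (r y)], hence [B (r ^ 2 x) y = B (r x) (r y)
= r ^ 2 B x y], and every nonnegative real is a square. *)
Lemma nnform_polar : nnform (polar Q).
Proof.
have ii z : 'i%C *: ('i%C *: z) = - z :> X.
  by rewrite scalerA -expr2 sqr_i scaleN1r.
split=> [y a u v|x a u v|x] /=; rewrite !polarE.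
- by apply: complex_ext; rewrite !ReImE /= BD BZl ?ii ?BNr; ring.
- apply: complex_ext; rewrite !ReImE /=; first by rewrite BDr (BZr a); ring.
  by rewrite scalerDr scalerA ['i%C * a]mulrC -scalerA BDr (BZr a) ii BNr; ring.
- by rewrite B_diag B_diag_i lecE /= eqxx Q_ge0.
Qed.

Lemma quad_polar x : quad (polar Q) x = Q x.
Proof. by rewrite /quad polarE /= B_diag. Qed.

End JordanVonNeumann.

(** * The parallel sum *)

Section ParallelSum.
Set Implicit Arguments.
Unset Strict Implicit.
Context {R : realType} {X : lmodType R[i]}.
Implicit Types (t w s p : X -> X -> R[i]) (x y : X).

(** The infimum defining the parallel sum inherits the two inequalities of
[nnform_polar] from [t] and [w], by moving the competitor [y] along. *)
Lemma parallel_sumP t w : nnform t -> nnform w ->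
  is_parallel_sum t w (parallel_sum t w).
Proof.
move=> ht hw; apply: (xgetPex (0 : X -> X -> R[i])
  (P := [set p | is_parallel_sum t w p])).
pose E x := [set quad w (x - y) + quad t y | y in [set: X]].
pose Q x := inf (E x).
have E0 x : E x !=set0 by exists (quad w (x - 0) + quad t 0); exists 0.
have lbE x : lbound (E x) 0.
  by move=> _ [y _ <-]; rewrite addr_ge0 ?(quad_ge0 ht) ?(quad_ge0 hw).
have QE x y : Q x <= quad w (x - y) + quad t y.
  by apply: ge_inf; [exists 0; exact: lbE | exists y].
have le_Q c x : (forall y, c <= quad w (x - y) + quad t y) -> c <= Q x.
  by move=> h; apply: lb_le_inf => // _ [y _ <-].
have Q_ge0 x : 0 <= Q x by exact: lb_le_inf.
have Q_scale_le a x :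
    Q (a *: x) <= (complex.Re a ^+ 2 + complex.Im a ^+ 2) * Q x.
  have [m0|m0] := ltP 0 (complex.Re a ^+ 2 + complex.Im a ^+ 2).
    rewrite -ler_pdivrMl //; apply: le_Q => y; rewrite ler_pdivrMl //.
    apply: (le_trans (QE _ (a *: y))).
    by rewrite -scalerBr (quadZ ht) (quadZ hw) mulrDr.
  (* The remaining case is [a = 0]; the competitor [a x] gives the value [0]. *)
  have mE : complex.Re a ^+ 2 + complex.Im a ^+ 2 = 0.
    by apply/eqP; rewrite eq_le m0 addr_ge0 ?sqr_ge0.
  rewrite mE mul0r; apply: (le_trans (QE _ (a *: x))).
  by rewrite subrr (quad0 hw) (quadZ ht) mE mul0r addr0.
have Q_par_le x x' : Q (x + x') + Q (x - x') <= 2 * Q x + 2 * Q x'.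
  set A := Q (x + x') + Q (x - x').
  have step y : A / 2 - (quad w (x - y) + quad t y) <= Q x'.
    apply: le_Q => y'.
    have := lerD (QE (x + x') (y + y')) (QE (x - x') (y - y')).
    have -> : x + x' - (y + y') = (x - y) + (x' - y') by rewrite opprD addrACA.
    have -> : x - x' - (y - y') = (x - y) - (x' - y') by rewrite opprD addrACA -opprD.
    have := quad_parallelogram hw (x - y) (x' - y').
    have := quad_parallelogram ht y y'.
    rewrite -/A; lra.
  have : A / 2 - Q x' <= Q x by apply: le_Q => y; have := step y; lra.
  lra.
exists (polar Q); split; first exact: nnform_polar.
by move=> x; rewrite quad_polar.
Qed.

Section Bounds.
Context {t w : X -> X -> R[i]} (ht : nnform t) (hw : nnform w).

Lemma nnform_parallel_sum : nnform (parallel_sum t w).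
Proof. by case: (parallel_sumP ht hw). Qed.

Let E x := [set quad w (x - y) + quad t y | y in [set: X]].

Let E_neq0 x : E x !=set0.
Proof. by exists (quad w (x - 0) + quad t 0); exists 0. Qed.

Let lbE x : has_lbound (E x).
Proof.
by exists 0 => _ [y _ <-]; rewrite addr_ge0 ?(quad_ge0 ht) ?(quad_ge0 hw).
Qed.

Lemma quad_parallel_sum_le x y :
  quad (parallel_sum t w) x <= quad w (x - y) + quad t y.
Proof.
by case: (parallel_sumP ht hw) => _ ->; apply: ge_inf; [exact: lbE|exists y].
Qed.

Lemma le_quad_parallel_sum (c : R) x :
  (forall y, c <= quad w (x - y) + quad t y) -> c <= quad (parallel_sum t w) x.
Proof.
case: (parallel_sumP ht hw) => _ -> h; apply: lb_le_inf; first exact: E_neq0.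
by move=> _ [y _ <-].
Qed.

Lemma parallel_sum_approx (e : R) x : 0 < e ->
  exists y, quad w (x - y) + quad t y < quad (parallel_sum t w) x + e.
Proof.
move=> e0; have [|_ [y _ <-] ?] := @inf_adherent _ (E x) e e0.
  by split; [exact: E_neq0|exact: lbE].
by exists y; case: (parallel_sumP ht hw) => _ ->.
Qed.

Lemma parallel_sum_le_l : form_le (parallel_sum t w) t.
Proof.
by move=> x; have := quad_parallel_sum_le x x; rewrite subrr (quad0 hw) add0r.
Qed.

Lemma parallel_sum_le_r : form_le (parallel_sum t w) w.
Proof.
by move=> x; have := quad_parallel_sum_le x 0; rewrite subr0 (quad0 ht) addr0.
Qed.

Lemma nnform_mu : nnform (mu w t).
Proof.
by apply: nnform_sub => //; [exact: nnform_parallel_sum|exact: parallel_sum_le_l].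
Qed.

End Bounds.

Lemma parallel_sum_mono t t' w : nnform t -> nnform t' -> nnform w ->
  form_le t t' -> form_le (parallel_sum t w) (parallel_sum t' w).
Proof.
move=> ht ht' hw tt' x; apply: le_quad_parallel_sum => // y.
by apply: le_trans (quad_parallel_sum_le ht hw x y) _; rewrite lerD2l.
Qed.

(** Since [s : s = s / 2], the parallel sum dominates half of every common
minorant; this is how mutual singularity is detected. *)
Lemma half_le_parallel_sum s t w : nnform s -> nnform t -> nnform w ->
  form_le s t -> form_le s w ->
  forall x, quad s x / 2 <= quad (parallel_sum t w) x.
Proof.
move=> hs ht hw st sw x; apply: le_quad_parallel_sum => // y.
have := quadD_le hs (x - y) y; rewrite subrK.
have := st y; have := sw (x - y); lra.
Qed.

End ParallelSum.

(** * Limits of forms *)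

Section Limits.
Set Implicit Arguments.
Unset Strict Implicit.
Context {R : realType} {X : lmodType R[i]}.
Implicit Types (t w s p : X -> X -> R[i]) (x y : X).

Lemma cvg_real_complex (f : nat -> R) (l : R) :
  f n @[n --> \oo] --> l ->
  ((f n)%:C%C : R[i]^o) @[n --> \oo] --> (l%:C%C : R[i]^o).
Proof.
move=> fl; apply/cvgrPdist_lt => e e0.
have [er e0'] : e = (complex.Re e)%:C%C /\ 0 < complex.Re e.
  by move: e0; rewrite ltcE => /andP[/eqP /= i0 ?]; split=> //; exact: complex_ext.
move/cvgrPdist_lt : fl => /(_ _ e0'); apply: filterS => n.
suff -> : `|l%:C%C - (f n)%:C%C : R[i]^o| = `|l - f n|%:C%C :> R[i].
  by rewrite [in X in _ -> X]er ltcR.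
rewrite -rmorphB; apply: etrans (normc_def _) _.
by rewrite /= expr0n addr0 sqrtr_sqr.
Qed.

Lemma cvg_polar (Q : nat -> X -> R) (L : X -> R) x y :
  (forall z, Q n z @[n --> \oo] --> L z) ->
  (polar (Q n) x y : R[i]^o) @[n --> \oo] --> (polar L x y : R[i]^o).
Proof.
move=> QL; rewrite /polar.
have cE (a b : R) : Complex a b = a%:C%C + 'i%C * b%:C%C :> R[i]^o.
  by rewrite [LHS]complexE.
under eq_fun do rewrite cE.
have cvg_part z z' :
    ((Q n z - Q n z') / 4)%:C%C @[n --> \oo] --> (((L z - L z') / 4)%:C%C : R[i]^o).
  by apply: cvg_real_complex; apply: cvgMr_tmp; apply: cvgB.
by rewrite cE; apply: cvgD; [|apply: cvgMl_tmp]; exact: cvg_part.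
Qed.

(** By polarization, convergence of the quadratic functionals is convergence of
the forms. *)
Lemma cvg_form (T : nat -> X -> X -> R[i]) (u : X -> X -> R[i]) x y :
  (forall n, nnform (T n)) -> nnform u ->
  (forall z, quad (T n) z @[n --> \oo] --> quad u z) ->
  (T n x y : R[i]^o) @[n --> \oo] --> (u x y : R[i]^o).
Proof.
move=> hT hu Tu; rewrite (polar_quad hu).
under eq_fun do rewrite (polar_quad (hT _)).
exact: cvg_polar.
Qed.

(** The parallelogram law and homogeneity survive pointwise limits, so the
Jordan-von Neumann theorem turns the limit of the quadratic functionals into a
form. *)
Lemma nonincreasing_form_limit (T : nat -> X -> X -> R[i]) :
  (forall n, nnform (T n)) -> (forall n, form_le (T n.+1) (T n)) ->
  exists2 u, nnform u & forall x, quad (T n) x @[n --> \oo] --> quad u x.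
Proof.
move=> hT Tle.
pose L x := limn (fun n => quad (T n) x).
have TL x : quad (T n) x @[n --> \oo] --> L x.
  apply: nonincreasing_is_cvgn; first by apply/nonincreasing_seqP => n; exact: Tle.
  by exists 0 => _ [n _ <-]; exact: quad_ge0.
have L_ge0 x : 0 <= L x.
  by apply: limr_ge; [exact: TL|near=> n; exact: quad_ge0].
have LZ a x : L (a *: x) <= (complex.Re a ^+ 2 + complex.Im a ^+ 2) * L x.
  rewrite le_eqVlt; apply/orP; left; apply/eqP/cvg_lim => //.
  by under eq_fun do rewrite (quadZ (hT _)); exact: cvgMl_tmp.
have L_par x y : L (x + y) + L (x - y) <= 2 * L x + 2 * L y.
  rewrite le_eqVlt; apply/orP; left; apply/eqP.
  have lhs : quad (T n) (x + y) + quad (T n) (x - y) @[n --> \oo]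
      --> L (x + y) + L (x - y) by exact: cvgD.
  have rhs : quad (T n) (x + y) + quad (T n) (x - y) @[n --> \oo]
      --> 2 * L x + 2 * L y.
    under eq_fun do rewrite (quad_parallelogram (hT _)).
    by apply: cvgD; exact: cvgMl_tmp.
  by rewrite -(cvg_lim (@Rhausdorff R) lhs) -(cvg_lim (@Rhausdorff R) rhs).
exists (polar L) => [|x]; first exact: nnform_polar.
by rewrite quad_polar.
Unshelve. all: end_near. Qed.

End Limits.

(** * Suprema of dominated forms are closable *)

Section Closability.
Set Implicit Arguments.
Unset Strict Implicit.
Context {R : realType} {X : lmodType R[i]}.

(** For large [n] and [m] one has [p N (z n - z m) <= e / 2] uniformly in [N];
letting [m] tend to infinity removes [z m], since [p N (z m)] is at most
[c N * w (z m)], and then [N] is free to grow. *)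
Lemma closable_of_dominated (r w : X -> X -> R[i]) (p : nat -> X -> X -> R[i])
    (c : nat -> R) :
  nnform r -> (forall n, nnform (p n)) ->
  (forall n, form_le (p n) r) ->
  (forall n x, quad (p n) x <= c n * quad w x) ->
  (forall x, quad (p n) x @[n --> \oo] --> quad r x) ->
  closable r w.
Proof.
move=> hr hp pr pw p_r z zC zw; apply/cvgr0Pnorm_le => e e0.
have e20 : 0 < e / 2 by rewrite divr_gt0.
move/cvgr0Pnorm_le : zC => /(_ _ e20) [[A1 A2] /= [A1oo A2oo] A12].
apply: filterS A1oo => n A1n; rewrite ger0_norm ?quad_ge0 //.
apply: (cvgr_to_le (p_r (z n))); apply: nearW => N.
have lim_m : e + 2 * c N * quad w (z m) @[m --> \oo] --> e + 2 * c N * 0.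
  by apply: cvgD; [exact: cvg_cst|exact: cvgMl_tmp].
rewrite mulr0 addr0 in lim_m; apply: (cvgr_to_ge lim_m).
apply: filterS A2oo => m A2m.
have /= := A12 (n, m) (conj A1n A2m); rewrite ger0_norm ?quad_ge0 //.
have := quadD_le (hp N) (z n - z m) (z m); rewrite subrK.
have := pr N (z n - z m); have := pw N (z m); lra.
Qed.

End Closability.

(** * The iteration *)

Section Iteration.
Set Implicit Arguments.
Unset Strict Implicit.
Context {R : realType} {X : lmodType R[i]}.
Context {t w u : X -> X -> R[i]}.
Hypotheses (ht : nnform t) (hw : nnform w) (hu : nnform u).

Local Notation T := (fun n => iter n (mu w) t).

Lemma nnform_iter_mu n : nnform (T n).
Proof. by elim: n => [//|n IH] /=; exact: nnform_mu. Qed.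

Lemma quad_iter_muS n x :
  quad (T n) x - quad (T n.+1) x = quad (parallel_sum (T n) w) x.
Proof. by rewrite /= quad_sub opprB addrC subrK. Qed.

Lemma iter_muS_le n : form_le (T n.+1) (T n).
Proof.
move=> x; rewrite -subr_ge0 quad_iter_muS.
by rewrite quad_ge0 //; apply: nnform_parallel_sum => //; exact: nnform_iter_mu.
Qed.

Lemma iter_mu_le n m : (n <= m)%N -> form_le (T m) (T n).
Proof.
move=> nm x; have /nonincreasing_seqP : forall k, quad (T k.+1) x <= quad (T k) x.
  by move=> k; exact: iter_muS_le.
exact.
Qed.

Lemma t_sub_iter_mu_le n x : quad t x - quad (T n) x <= n%:R * quad w x.
Proof.
elim: n => [|n IH]; first by rewrite /= subrr mul0r.
have := parallel_sum_le_r (nnform_iter_mu n) hw x.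
rewrite -quad_iter_muS -natr1; lra.
Qed.

(** The increments [T j : w] decrease with [j], so each is at most the mean of
those before it. This rate of decay, better than mere convergence to [0], is
what maximality rests on. *)
Lemma mulr_parallel_sum_le k j x :
  j.+1%:R * quad (parallel_sum (T (k + j)%N) w) x <=
  quad (T k) x - quad (T (k + j).+1) x.
Proof.
elim: j => [|j IH]; first by rewrite addn0 mul1r quad_iter_muS.
rewrite addnS -natr1 mulrDl mul1r -[in X in _ + X <= _]quad_iter_muS.
suff : j.+1%:R * quad (parallel_sum (T (k + j).+1) w) x <=
       j.+1%:R * quad (parallel_sum (T (k + j)%N) w) x by lra.
rewrite ler_pM2l ?ltr0n //; apply: parallel_sum_mono => //;
  [exact: nnform_iter_mu|exact: nnform_iter_mu|exact: iter_muS_le].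
Qed.

Hypothesis Tu : forall x, quad (T n) x @[n --> \oo] --> quad u x.

Lemma limit_le_iter_mu n : form_le u (T n).
Proof.
move=> x; apply: (cvgr_to_le (@Tu x)).
by near=> m; apply: iter_mu_le; near: m; exact: nbhs_infty_ge.
Unshelve. all: end_near. Qed.

(** The partial sums [t - T n] of the parallel sums [T j : w] are dominated by
multiples of [w] and increase to [t - u]. *)
Lemma closable_t_sub_limit : closable (t - u) w.
Proof.
have tu : form_le u t := limit_le_iter_mu 0.
have tT n : form_le (T n) t := iter_mu_le (leq0n n).
apply: (closable_of_dominated (p := fun n => t - T n) (c := fun n => n%:R)).
- exact: nnform_sub.
- by move=> n; apply: nnform_sub => //; exact: nnform_iter_mu.
- by move=> n x; rewrite !quad_sub lerD2l lerN2 limit_le_iter_mu.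
- by move=> n x; rewrite quad_sub t_sub_iter_mu_le.
- move=> x; rewrite quad_sub; under eq_fun do rewrite quad_sub.
  by apply: cvgB => //; exact: cvg_cst.
Qed.

(** A common minorant [s] of [u] and [w] satisfies [s / 2 <= T n : w] for all
[n], and the increments [T n : w] tend to [0]. *)
Lemma mutually_singular_limit : mutually_singular u w.
Proof.
move=> s hs su sw; apply: quad_inj => // [|x]; first exact: nnform0.
rewrite [RHS]/quad /=.
apply/eqP; rewrite eq_le (quad_ge0 hs) andbT.
have incr0 : quad (T n) x - quad (T n.+1) x @[n --> \oo] --> quad u x - quad u x.
  by apply: cvgB => //; rewrite (cvg_shiftS (fun n => quad (T n) x)).
have : quad s x / 2 <= quad u x - quad u x.
  apply: (cvgr_to_ge incr0); apply: nearW => n; rewrite quad_iter_muS.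
  apply: half_le_parallel_sum => //; first exact: nnform_iter_mu.
  by move=> y; apply: le_trans (su y) (limit_le_iter_mu n y).
by rewrite subrr; lra.
Qed.

(** * Maximality *)

Section Maximality.
Variable x : X.

Let gap k := quad (T k) x - quad u x.

(** The first term bounds [(2 k + 1) (T (2 k) : w)[x]], the second is the slack
allowed in the choice of a near-minimizer. *)
Let err k := 2 * gap k + k.+1%:R^-1.

Let gap_to0 : gap k @[k --> \oo] --> (0 : R).
Proof. by rewrite -(subrr (quad u x)); apply: cvgB => //; exact: cvg_cst. Qed.

Let err_to0 : err k @[k --> \oo] --> (0 : R).
Proof.
rewrite -(addr0 0) -[X in X + 0](mulr0 2).
by apply: cvgD; [exact: cvgMl_tmp|exact: cvg_harmonic].
Qed.

(** The vectors [z k] approximate the projection of [x] onto the kernel of [w] in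
the completion. A near-minimizer for [(T (2 k) : w)[x]] is taken; the factor
[2 k + 1] in front of [w[z k]] is affordable because [(2 k + 1) (T (2 k) : w)[x]]
is at most [2 gap k] by [mulr_parallel_sum_le], and it is needed because
[t - T (2 k)] is only bounded by [2 k w]. *)
Lemma approx_singular_component : exists z : nat -> X, forall k,
  [/\ quad w (z k) <= err k,
      quad (t - T k.*2) (z k) <= err k
    & quad (T k.*2) (x - z k) <= err k].
Proof.
suff /choice[z hz] : forall k, exists z, [/\ quad w z <= err k,
    quad (t - T k.*2) z <= err k & quad (T k.*2) (x - z) <= err k].
  by exists z.
move=> k; have hT := nnform_iter_mu k.*2.
pose N : R := k.*2.+1%:R.
have N1 : 1 <= N by rewrite ler1n.
have N0 : 0 < N by exact: lt_le_trans N1.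
have eta0 : 0 < (N * k.+1%:R)^-1 by rewrite invr_gt0 mulr_gt0 ?ltr0n.
have [y hy] := parallel_sum_approx hT hw x eta0.
have sum_le : N * (quad w (x - y) + quad (T k.*2) y) <= err k.
  apply: le_trans (_ : N * quad (parallel_sum (T k.*2) w) x + k.+1%:R^-1 <= _).
    rewrite -[k.+1%:R^-1](mulVKf (lt0r_neq0 N0)) -mulrDr ler_pM2l //.
    by rewrite -invfM; exact: ltW.
  rewrite /err lerD2r.
  have := mulr_parallel_sum_le k k x; rewrite addnn.
  have := limit_le_iter_mu k.*2.+1 x.
  have p0 := quad_ge0 (nnform_parallel_sum hT hw) x.
  rewrite /gap /N -addnn -!natr1 natrD; rewrite addnn.
  set p := quad (parallel_sum _ _) x in p0 *; move=> h1 h2.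
  have := mulr_ge0 (ler0n R k) p0; lra.
have w0 := quad_ge0 hw (x - y); have T0 := quad_ge0 hT y.
have wN : N * quad w (x - y) <= err k.
  by apply: le_trans sum_le; rewrite ler_pM2l // lerDl.
exists (x - y); split.
- by apply: le_trans wN; rewrite ler_peMl.
- rewrite quad_sub; apply: le_trans (t_sub_iter_mu_le _ _) _.
  by apply: le_trans wN; rewrite ler_wpM2r // ler_nat.
- rewrite opprB addrC subrK; apply: le_trans sum_le.
  by apply: le_trans (_ : _ <= N * quad (T k.*2) y) _;
    rewrite ?ler_peMl // ler_pM2l // lerDr.
Qed.

Variables (z : nat -> X).
Hypothesis hz : forall k,
  [/\ quad w (z k) <= err k,
      quad (t - T k.*2) (z k) <= err k
    & quad (T k.*2) (x - z k) <= err k].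

(** The estimate below produces [4 err n + 8 err m + 4 gap n] for [n <= m]; the
constants are enlarged so that [bound n + bound m] also serves for [m < n]. *)
Let bound k := 12 * err k + 4 * gap k.

Let err_ge0 k : 0 <= err k.
Proof. by case: (hz k) => h _ _; apply: le_trans h; exact: quad_ge0. Qed.

Let gap_ge0 k : 0 <= gap k.
Proof. by rewrite subr_ge0; exact: limit_le_iter_mu. Qed.

(* [t = (t - P) + P] with [P = T n.*2]: the first form is small at [z n] and
   [z m], the second at [x - z n] and [x - z m], where [P - S = T n.*2 - T m.*2]
   is small at [x] because the iterates converge. *)
Let approx_cauchy_le n m : (n <= m)%N -> quad t (z n - z m) <= bound n + bound m.
Proof.
move=> nm; have nm2 : (n.*2 <= m.*2)%N by rewrite leq_double.
pose P := T n.*2; pose S := T m.*2.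
have hP : nnform P := nnform_iter_mu _; have hS : nnform S := nnform_iter_mu _.
have hTP : nnform (t - P) by apply: nnform_sub => //; exact: (iter_mu_le (leq0n _)).
have hPS : nnform (P - S) by apply: nnform_sub => //; exact: iter_mu_le.
have [_ n2 n3] := hz n; have [_ m2 m3] := hz m.
have SP y : quad S y <= quad P y := iter_mu_le nm2 y.
have Pt y : quad P y <= quad t y := iter_mu_le (leq0n _) y.
have PS_x : quad (P - S) x <= gap n.
  rewrite quad_sub /gap; have := limit_le_iter_mu m.*2 x.
  have := @iter_mu_le n n.*2 _ x; rewrite -addnn leq_addr addnn => /(_ isT).
  by rewrite -/P -/S; lra.
have a1 := quadB_le hTP (z n) (z m).
have a2 := quadB_le hP (x - z m) (x - z n).
have a3 := quadB_le hPS x (z m).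
have eq_sub : (x - z m) - (x - z n) = z n - z m.
  by rewrite opprB addrC addrA subrK.
rewrite eq_sub in a2.
move: n2 n3 m2 m3 a1 a2 a3 PS_x; rewrite !quad_sub -/P -/S.
have := SP (z m); have := Pt (z m).
have := err_ge0 n; have := err_ge0 m; have := gap_ge0 n; have := gap_ge0 m.
rewrite /bound; lra.
Qed.

Lemma approx_cauchy : quad t (z nm.1 - z nm.2) @[nm --> (\oo, \oo)] --> (0 : R).
Proof.
have bound_to0 : bound k @[k --> \oo] --> (0 : R).
  rewrite -(addr0 0) -[X in X + 0](mulr0 12) -[X in _ + X](mulr0 4).
  by apply: cvgD; exact: cvgMl_tmp.
apply: (@squeeze_cvgr _ _ _ _ (fun=> 0) (fun nm => bound nm.1 + bound nm.2)).
- apply: nearW => -[n m] /=; rewrite quad_ge0 //=.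
  have [nm|mn] := leqP n m; first exact: approx_cauchy_le.
  by rewrite (quad_subC ht) [bound n + _]addrC; apply: approx_cauchy_le; exact: ltnW.
- exact: cvg_cst.
- rewrite -(addr0 0); apply: cvgD.
    exact: (cvg_comp _ _ (@cvg_fst _ _ _ _ _) bound_to0).
  exact: (cvg_comp _ _ (@cvg_snd _ _ _ _ _) bound_to0).
Qed.

Lemma approx_w_to0 : quad w (z k) @[k --> \oo] --> (0 : R).
Proof.
apply: (@squeeze_cvgr _ _ _ _ (fun=> 0) err) => //; last exact: cvg_cst.
by apply: nearW => k; rewrite quad_ge0 //=; case: (hz k).
Qed.

(** Closability annihilates the part [z k] of [x]; what remains is at most
[t[x - z k]], which splits into [T k.*2] at [x - z k], small, and [t - T k.*2]
at [x - z k], close to its value at [x]. *)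
Lemma closable_le_at (s : X -> X -> R[i]) : nnform s -> form_le s t ->
  closable s w -> quad s x <= quad t x - quad u x.
Proof.
move=> hs st sw.
have s_to0 : quad s (z k) @[k --> \oo] --> (0 : R).
  apply: sw approx_w_to0.
  apply: (@squeeze_cvgr _ _ _ _ (fun=> 0) (fun nm => quad t (z nm.1 - z nm.2))).
  - by apply: nearW => nm; rewrite quad_ge0 // st.
  - exact: cvg_cst.
  - exact: approx_cauchy.
set A := quad t x - quad u x.
have weighted (d : R) : 0 < d -> quad s x <= (1 + d) * ((1 + d) * A).
  move=> d0.
  have lim_k : (1 + d) * ((1 + d) * A + (2 + d^-1) * err k)
        + (1 + d^-1) * quad s (z k) @[k --> \oo]
      --> (1 + d) * ((1 + d) * A + (2 + d^-1) * 0) + (1 + d^-1) * 0.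
    apply: cvgD; apply: cvgMl_tmp => //.
    by apply: cvgD; [exact: cvg_cst|exact: cvgMl_tmp].
  rewrite !mulr0 !addr0 in lim_k.
  apply: (cvgr_to_ge lim_k); apply: nearW => k.
  have [_ z2 z3] := hz k.
  have hT := nnform_iter_mu k.*2.
  have htT : nnform (t - T k.*2).
    by apply: nnform_sub => //; exact: (iter_mu_le (leq0n _)).
  have := quadD_le_weighted hs (x - z k) (z k) d0; rewrite subrK => h.
  apply: le_trans h _; rewrite lerD2r ler_pM2l ?addr_gt0 //.
  apply: le_trans (st _) _.
  have := quadD_le_weighted htT x (- z k) d0; rewrite (quadN htT).
  have d10 : 0 < 1 + d^-1 by rewrite addr_gt0 ?invr_gt0.
  have := ler_wpM2l (ltW d10) z2.
  have d1 : 0 < 1 + d by rewrite addr_gt0.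
  have : quad (t - T k.*2) x <= A.
    by rewrite quad_sub lerD2l lerN2 limit_le_iter_mu.
  move/(ler_wpM2l (ltW d1)); move: z2 z3; rewrite !quad_sub; lra.
have lim_d : (1 + n.+1%:R^-1) * ((1 + n.+1%:R^-1) * A) @[n --> \oo]
    --> (1 + 0) * ((1 + 0) * A).
  have h1 : 1 + n.+1%:R^-1 @[n --> \oo] --> (1 + 0 : R).
    by apply: cvgD; [exact: cvg_cst|exact: cvg_harmonic].
  by apply: cvgM => //; exact: cvgMr_tmp.
rewrite addr0 !mul1r in lim_d.
apply: (cvgr_to_ge lim_d); apply: nearW => n.
by apply: weighted; rewrite invr_gt0 ltr0n.
Qed.

End Maximality.

Lemma closable_le_t_sub_limit (s : X -> X -> R[i]) :
  nnform s -> form_le s t -> closable s w -> form_le s (t - u).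
Proof.
move=> hs st sw x; rewrite quad_sub.
have [z hz] := approx_singular_component x.
exact: closable_le_at hz _ hs st sw.
Qed.

End Iteration.

Theorem theorem4p2 (R : realType) (X : lmodType R[i]) (t w : X -> X -> R[i])
    (ht : nnform t) (hw : nnform w) :
  let ts := singular_part t w in
  lebesgue_type_decomposition t w (t - ts) ts /\
  is_largest [set s | [/\ nnform s, form_le s t & closable s w]] (t - ts).
Proof.
have hT := nnform_iter_mu ht hw.
have [u hu Tu] := nonincreasing_form_limit hT (iter_muS_le ht hw).
have -> : singular_part t w = u.
  apply/funext => x; apply/funext => y.
  have Txy := cvg_form (x := x) (y := y) hT hu Tu.
  by have lim_eq := cvg_lim (@norm_hausdorff _ (R[i]^o)) Txy; apply: lim_eq.
have ut : form_le u t := limit_le_iter_mu ht hw Tu 0.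
have htu : nnform (t - u) by exact: nnform_sub.
have tu_t : form_le (t - u) t.
  by move=> x; rewrite quad_sub lerBlDr lerDl quad_ge0.
have tu_w : closable (t - u) w := closable_t_sub_limit ht hw hu Tu.
split; last first.
  by split=> // s [hs st sw]; exact: closable_le_t_sub_limit Tu s hs st sw.
split=> //; last exact: mutually_singular_limit Tu.
by rewrite subrK.
Qed.
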